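(* Let $n\ge1$ and let $\lambda=(\lambda_1,\dots,\lambda_n)$ be a real partition. Let $0\le j\le n-1$, let $U=(u_{j+1},\dots,u_{n-1})$ be a sequence of $n-1-j$ real numbers in $(0,1]$ and let $t\in(0,1]$. Then the pseudo-affinity factor satisfies $$\alpha(0^{j},U;0,1,t)=t\,\frac{S_\mu(U,t)\,S_\eta(U,1)}{S_\mu(U,1)\,S_\eta(U,t)},$$ where $\mu=(\lambda_1,\lambda_2,\dots,\lambda_{n-j})$ and $\eta=(\lambda_2,\lambda_3,\dots,\lambda_{n-j+1})$, with the convention $\lambda_{n+1}=0$.
   Context: A real partition is a real tuple $\lambda=(\lambda_1,\dots,\lambda_n)$ with $\lambda_1>\lambda_2-1>\cdots>\lambda_n-(n-1)>-n$. Its bottom partition is $\lambda^{(0)}=(\lambda_2,\dots,\lambda_n)$. Schur functions: for a real tuple $\nu=(\nu_1,\dots,\nu_m)$ with $\nu_1>\nu_2-1>\cdots>\nu_m-(m-1)$ and positive, pairwise distinct $v_1,\dots,v_m$, $S_\nu(v_1,\dots,v_m)=\det(v_i^{\nu_j+m-j})_{1\le i,j\le m}\big/\prod_{1\le i<j\le m}(v_i-v_j)$, extended by continuity to coinciding positive arguments. If there are more arguments than components, zeros are appended to the tuple; the Schur function of the empty partition is $1$. The notation $\epsilon^{m}$ among the arguments of $S$ means that $\epsilon$ is repeated $m$ times. The pseudo-affinity factor (of the Müntz space attached to $\lambda$, over $[0,1]$) is defined by $$\alpha(0^{j},U;0,1,t)=\lim_{\epsilon\to0^+} t\,\frac{S_\lambda(\epsilon^{j+1},U,t)\,S_{\lambda^{(0)}}(\epsilon^{j},U,1)}{S_\lambda(\epsilon^{j+1},U,1)\,S_{\lambda^{(0)}}(\epsilon^{j},U,t)}.$$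 *)

(* Defs.v *)
From mathcomp Require Import all_boot all_order all_algebra.
From mathcomp Require Import all_classical all_reals all_analysis.

Set Implicit Arguments.
Unset Strict Implicit.
Unset Printing Implicit Defensive.

Import Order.TTheory GRing.Theory Num.Theory.
Import numFieldNormedType.Exports.

Local Open Scope classical_set_scope.
Local Open Scope ring_scope.

(* Components are numbered from 0, and [lam`_i = 0] for [size lam <= i]: the
   case [i = (size lam).-1] reads [lam_n - (n - 1) > - n]. *)
Definition real_partition (R : realType) (lam : seq R) : Prop :=
  forall i : nat, (i < size lam)%N ->
    lam`_i.+1 - i.+1%:R < lam`_i - i%:R.

(* Since [nu`_j = 0] for [size nu <= j], [nu] is implicitly padded with zeros
   when there are more arguments than components; components beyond the number
   of arguments would be ignored, so it is meant for [size nu <= m]. *)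
Definition schur_quotient (R : realType) (nu : seq R) (m : nat)
    (v : 'rV[R]_m) : R :=
  \det (\matrix_(i < m, j < m) (v 0 i `^ (nu`_j + (m - j.+1)%:R)))
  / \prod_(i < m) \prod_(j < m | (i < j)%N) (v 0 i - v 0 j).

Definition pos_distinct (R : realType) (m : nat) : set 'rV[R]_m :=
  [set v | (forall i, 0 < v 0 i) /\ injective (v 0)].

(* At coinciding arguments, the limit of the quotient along tuples of pairwise
   distinct positive arguments; meaningful for positive arguments only. *)
Definition schur (R : realType) (nu : seq R) (m : nat) (v : m.-tuple R) : R :=
  let w := \row_(i < m) tnth v i in
  if w \in @pos_distinct R m then schur_quotient nu w
  else lim (schur_quotient nu x @[x --> within (@pos_distinct R m) (nbhs w)]).

Definition pseudo_affinity_at (R : realType) (lam : seq R) (j m : nat)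
    (U : m.-tuple R) (t eps : R) : R :=
  t * ((schur lam [tuple of nseq j.+1 eps ++ rcons U t]
        * schur (behead lam) [tuple of nseq j eps ++ rcons U 1])
       / (schur lam [tuple of nseq j.+1 eps ++ rcons U 1]
          * schur (behead lam) [tuple of nseq j eps ++ rcons U t])).

Definition pseudo_affinity (R : realType) (lam : seq R) (j m : nat)
    (U : m.-tuple R) (t : R) : R :=
  lim (pseudo_affinity_at lam j U t eps @[eps --> 0^'+]).

(* Main.v *)
(* In the coordinates z_i = ln v_i the numerator of S_nu is det (exp (e_j z_i))
   with strictly increasing exponents e_j, and the denominator is the same
   determinant with e_j = j.  By Newton interpolation, det (exp (e_j z_i)) is
   prod_(r < i) (z_i - z_r) times the determinant of the divided differences
   exp(e_j .)[z_0, ..., z_i].  Divided differences of exponentials are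
   continuous in the nodes, coinciding or not, and their determinant never
   vanishes: an exponential sum with m terms has at most m - 1 real zeros,
   counted with multiplicity (Rolle).  So S_nu is a quotient of two continuous
   nonvanishing functions of z.
   When the first k arguments are equal to eps, each of the two determinants can
   be replaced by the one in which the divided differences of the two groups of
   arguments are taken separately, up to a factor that cancels in the quotient.
   After scaling rows and columns by powers of eps this block matrix tends to a
   block diagonal one, whence omega(eps) * S_nu (eps^k, V) --> C * S_nu (V) with
   omega and C independent of V; they cancel in the pseudo-affinity factor. *)
Require Import Defs.
From mathcomp Require Import all_boot all_order all_algebra.
From mathcomp Require Import all_classical all_reals all_analysis.
From mathcomp Require Import perm ring lra zify.

Set Implicit Arguments.
Unset Strict Implicit.
Unset Printing Implicit Defensive.

Import Order.TTheory GRing.Theory Num.Theory.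
Import numFieldNormedType.Exports.

Local Open Scope classical_set_scope.
Local Open Scope ring_scope.

(** * Limits of finite sums, products and determinants *)

Section CvgBigop.
Variables (R : realType) (T : Type) (F : set_system T) (FF : Filter F).

Lemma cvg_sumR (I : Type) (r : seq I) (P : pred I) (f : I -> T -> R) (l : I -> R) :
    (forall i, P i -> f i t @[t --> F] --> l i) ->
  \sum_(i <- r | P i) f i t @[t --> F] --> \sum_(i <- r | P i) l i.
Proof. by move=> fl; apply: cvg_big => //; exact: add_continuous. Qed.

Lemma cvg_prodR (I : Type) (r : seq I) (P : pred I) (f : I -> T -> R) (l : I -> R) :
    (forall i, P i -> f i t @[t --> F] --> l i) ->
  \prod_(i <- r | P i) f i t @[t --> F] --> \prod_(i <- r | P i) l i.
Proof. by move=> fl; apply: cvg_big => //; exact: mul_continuous. Qed.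

Lemma cvg_det m (A : T -> 'M[R]_m) (B : 'M[R]_m) :
    (forall i j, A t i j @[t --> F] --> B i j) ->
  \det (A t) @[t --> F] --> \det B.
Proof.
move=> AB; rewrite /determinant; apply: cvg_sumR => s _.
by apply: cvgM; [exact: cvg_cst|apply: cvg_prodR].
Qed.

End CvgBigop.

(** * Divided differences of exponentials *)

(* Divided difference of [x ^ n] at the nodes [s] (0 when [s] is empty),
   computed by the Leibniz rule for the product [x * x ^ n']. *)
Fixpoint monom_dd (R : pzRingType) (n : nat) (s : seq R) : R :=
  if n is n'.+1 then head 0 s * monom_dd n' s + monom_dd n' (behead s)
  else (size s == 1)%:R.

Section MonomialDividedDifferences.
Variable R : comPzRingType.
Implicit Types (x y a : R) (s : seq R) (n : nat).

Lemma monom_dd_nil n : monom_dd n ([::] : seq R) = 0.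
Proof. by elim: n => //= n ->; rewrite mulr0 addr0. Qed.

(** The recurrence of divided differences; free of division, it also covers coinciding nodes. *)
Lemma monom_dd_sub n x y s :
  monom_dd n (x :: s) - monom_dd n (y :: s) = (x - y) * monom_dd n (x :: y :: s).
Proof.
elim: n => [|n IH] /=; first by rewrite subrr mulr0.
rewrite mulrDr mulrCA -IH; ring.
Qed.

Lemma monom_dd_swap n x y s :
  monom_dd n (x :: y :: s) = monom_dd n (y :: x :: s).
Proof.
elim: n => //= n IH; have := monom_dd_sub n x y s; rewrite -IH => H.
apply/eqP; rewrite -subr_eq0; apply/eqP.
transitivity ((x - y) * monom_dd n (x :: y :: s)
    - (monom_dd n (x :: s) - monom_dd n (y :: s))); first by ring.
by rewrite H subrr.
Qed.

(** Lets symmetry pass under a common first node: the recursion sees the tail only through its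
    divided differences and, in degree 0, its length. *)
Lemma monom_dd_cons x s s' : size s = size s' ->
    (forall n, monom_dd n s = monom_dd n s') ->
  forall n, monom_dd n (x :: s) = monom_dd n (x :: s').
Proof. by move=> ss ih; elim=> [|n IH] /=; rewrite ?ss// ih -/monom_dd IH. Qed.

Lemma monom_dd_move n x s1 s2 :
  monom_dd n (s1 ++ x :: s2) = monom_dd n (x :: s1 ++ s2).
Proof.
elim: s1 n => //= y s1 IH n.
rewrite (@monom_dd_cons y _ (x :: s1 ++ s2)) //; first exact: monom_dd_swap.
by rewrite /= !size_cat /= addnS.
Qed.

Lemma monom_dd1 n x : monom_dd n [:: x] = x ^+ n.
Proof. by elim: n => //= n ->; rewrite monom_dd_nil addr0 exprS. Qed.

(** At [r.+1] equal nodes the value is 'C(n, r) x^(n - r), so this is (r + 1) 'C(n + 1, r + 1) = (n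
    + 1) 'C(n, r). *)
Lemma monom_dd_nseqS n r x :
  r.+1%:R * monom_dd n.+1 (nseq r.+2 x) = n.+1%:R * monom_dd n (nseq r.+1 x).
Proof.
elim: n r => [|n IH] r.
  by case: r => [|r] /=; rewrite ?mulr0 ?add0r ?mulr0.
have E q m : monom_dd m.+1 (nseq q.+1 x)
  = x * monom_dd m (nseq q.+1 x) + monom_dd m (nseq q x) by [].
rewrite E mulrDr mulrCA IH [in RHS]E.
case: r => [|r]; first by rewrite E monom_dd_nil; ring.
rewrite -(natr1 r.+1) -(natr1 n.+1) [X in _ + X]mulrDl mul1r IH E; ring.
Qed.

End MonomialDividedDifferences.

(** The 1 in 1 + |x| <= K pays for the second term of the recursion: (K - 1) K^n + K^n = K^(n +
    1). *)
Lemma monom_dd_bound (R : realDomainType) (K : R) n s :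
  1 <= K -> (forall x, x \in s -> 1 + `|x| <= K) -> `|monom_dd n s| <= K ^+ n.
Proof.
move=> K1; elim: n s => [|n IH] s sK /=; first by rewrite expr0 normr_nat lern1 leq_b1.
have K0 : 0 <= K by rewrite (le_trans _ K1).
have hK : `|head 0 s| <= K - 1.
  case: s sK => [|x s] sK /=; first by rewrite normr0 subr_ge0.
  by rewrite lerBrDl sK ?mem_head.
rewrite (le_trans (ler_normD _ _))// exprS -[in leRHS](subrK 1 K) mulrDl mul1r subrK.
apply: lerD; first by rewrite normrM ler_pM ?IH.
by apply: IH => x /mem_behead; exact: sK.
Qed.

Section ExponentialDividedDifferences.
Variable R : realType.
Implicit Types (x y a : R) (s : seq R) (n : nat).

(** Term of degree n in the power series of exp (a x), with x^n replaced by its divided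
    difference. *)
Definition exp_dd_coeff a s n : R := a ^+ n / n`!%:R * monom_dd n s.

(* Divided difference of [fun x => expR (a * x)] at the nodes [s]. *)
Definition exp_dd a s : R := limn (series (exp_dd_coeff a s)).

Lemma exp_dd_coeff_bound a (K : R) s n :
    1 <= K -> (forall x, x \in s -> 1 + `|x| <= K) ->
  `|exp_dd_coeff a s n| <= exp_coeff (`|a| * K) n.
Proof.
move=> K1 sK; rewrite /exp_dd_coeff /exp_coeff /= exprMn normrM normrM normfV.
rewrite normr_nat normrX mulrAC ler_wpM2r ?invr_ge0//.
by rewrite ler_wpM2l ?exprn_ge0// monom_dd_bound.
Qed.

Lemma seq_bound s : exists2 K : R, 1 <= K & forall x, x \in s -> 1 + `|x| <= K.
Proof.
elim: s => [|y s [K K1 sK]]; first by exists 1.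
exists (Num.max K (1 + `|y|)) => [|x]; first by rewrite le_max K1.
by rewrite inE le_max => /orP[/eqP->|/sK->]//; rewrite lexx orbT.
Qed.

Lemma is_cvg_exp_dd_norm a s : cvgn [normed series (exp_dd_coeff a s)].
Proof.
have [K K1 sK] := seq_bound s.
apply: (@series_le_cvg _ (fun n => `|exp_dd_coeff a s n|) (exp_coeff (`|a| * K))).
- by move=> n; exact: normr_ge0.
- by move=> n; rewrite exp_coeff_ge0// mulr_ge0// (le_trans _ K1).
- by move=> n; exact: exp_dd_coeff_bound.
- exact: is_cvg_series_exp_coeff.
Qed.

Lemma cvg_exp_dd a s : series (exp_dd_coeff a s) @ \oo --> exp_dd a s.
Proof. exact: normed_cvg (@is_cvg_exp_dd_norm a s). Qed.

Lemma exp_dd_bound a (K : R) s : 1 <= K -> (forall x, x \in s -> 1 + `|x| <= K) ->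
  `|exp_dd a s| <= expR (`|a| * K).
Proof.
move=> K1 sK; apply: le_trans (lim_series_norm (@is_cvg_exp_dd_norm a s)) _.
apply: lim_series_le; first exact: is_cvg_exp_dd_norm.
  exact: is_cvg_series_exp_coeff.
by move=> n; exact: exp_dd_coeff_bound.
Qed.

Lemma exp_dd_sub a x y s :
  exp_dd a (x :: s) - exp_dd a (y :: s) = (x - y) * exp_dd a (x :: y :: s).
Proof.
have H1 : series (exp_dd_coeff a (x :: s)) n - series (exp_dd_coeff a (y :: s)) n
    @[n --> \oo] --> exp_dd a (x :: s) - exp_dd a (y :: s).
  by apply: cvgB; exact: cvg_exp_dd.
apply: (cvg_unique _ H1) => //.
rewrite [X in X @ _](_ : _ = fun n => (x - y) * series (exp_dd_coeff a (x :: y :: s)) n).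
  by apply: cvgM; [exact: cvg_cst|exact: cvg_exp_dd].
apply/funext => n; rewrite /series /= mulr_sumr -sumrB; apply: eq_bigr => i _.
by rewrite /exp_dd_coeff -mulrBr monom_dd_sub mulrCA.
Qed.

Lemma exp_dd_move a x s1 s2 : exp_dd a (s1 ++ x :: s2) = exp_dd a (x :: s1 ++ s2).
Proof.
by rewrite /exp_dd /exp_dd_coeff; under eq_fun do rewrite monom_dd_move.
Qed.

Lemma exp_dd1 a x : exp_dd a [:: x] = expR (a * x).
Proof.
rewrite /exp_dd /expR; congr (limn (series _)); apply/funext => n.
by rewrite /exp_dd_coeff /exp_coeff /= monom_dd1 exprMn mulrAC.
Qed.

(** Termwise from the monomial case after an index shift by one: the term of degree 0 vanishes at
    two or more nodes. *)
Lemma exp_dd_nseqS a r x :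
  r.+1%:R * exp_dd a (nseq r.+2 x) = a * exp_dd a (nseq r.+1 x).
Proof.
have H1 : series (exp_dd_coeff a (nseq r.+2 x)) n.+1 @[n --> \oo]
    --> exp_dd a (nseq r.+2 x).
  by rewrite cvg_shiftS; exact: cvg_exp_dd.
have {}H1 : r.+1%:R * series (exp_dd_coeff a (nseq r.+2 x)) n.+1 @[n --> \oo]
    --> r.+1%:R * exp_dd a (nseq r.+2 x).
  by apply: cvgM; [exact: cvg_cst|exact: H1].
apply: (cvg_unique _ H1) => //.
rewrite [X in X @ _](_ : _ = fun n => a * series (exp_dd_coeff a (nseq r.+1 x)) n).
  by apply: cvgM; [exact: cvg_cst|exact: cvg_exp_dd].
apply/funext => n; rewrite /series /= big_mkord big_ord_recl /=.
rewrite [X in X + _](_ : _ = 0) ?add0r; last by rewrite /exp_dd_coeff /= mulr0.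
rewrite big_mkord !mulr_sumr; apply: eq_bigr => i _.
rewrite /exp_dd_coeff /bump leq0n add1n mulrCA monom_dd_nseqS [LHS]mulrA.
rewrite [RHS]mulrA; congr (_ * _).
rewrite factS natrM exprS; field.
by rewrite -mulrS !pnatr_eq0 -lt0n fact_gt0.
Qed.

Lemma exp_dd_nseq a r x :
  exp_dd a (nseq r.+1 x) = a ^+ r / r`!%:R * expR (a * x).
Proof.
elim: r => [|r IH]; first by rewrite exp_dd1 expr0 fact0 divr1 mul1r.
have r0 : r.+1%:R != 0 :> R by rewrite pnatr_eq0.
apply: (mulfI r0); rewrite exp_dd_nseqS IH factS natrM exprS; field.
by rewrite -mulrS !pnatr_eq0 -lt0n fact_gt0.
Qed.

(** The nodes of [s2] are exchanged one at a time, each at the cost of |x - y| times a bounded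
    divided difference; [s1] collects the nodes already exchanged. *)
Lemma exp_dd_lipschitz a (K : R) s1 s2 s2' : 1 <= K -> size s2 = size s2' ->
    (forall x, x \in s1 ++ s2 ++ s2' -> 1 + `|x| <= K) ->
  `|exp_dd a (s1 ++ s2) - exp_dd a (s1 ++ s2')|
    <= expR (`|a| * K) * \sum_(i < size s2) `|s2`_i - s2'`_i|.
Proof.
move=> K1; elim: s2 s1 s2' => [|x s2 IH] s1 [|y s2']//=.
  by rewrite subrr normr0 big_ord0 mulr0.
move=> [ss] sK; rewrite big_ord_recl /= mulrDr.
rewrite -(subrK (exp_dd a (s1 ++ y :: s2)) (exp_dd a (s1 ++ x :: s2))) -addrA.
apply: (le_trans (ler_normD _ _)); apply: lerD.
  rewrite !exp_dd_move exp_dd_sub normrM mulrC ler_wpM2r//.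
  apply: exp_dd_bound => // z zs; apply: sK; move: zs.
  by rewrite !(inE, mem_cat) => /or4P[]->; rewrite ?orbT.
rewrite -!cat_rcons; apply: IH => // z zs; apply: sK; move: zs.
by rewrite !(inE, mem_cat, mem_rcons) => /or3P[/orP[]||]->; rewrite ?orbT.
Qed.

Lemma cvg_exp_dd_seq (T : Type) (F : set_system T) (FF : Filter F) a
    (f : T -> seq R) s :
    (forall t, size (f t) = size s) ->
    (forall i, (i < size s)%N -> (f t)`_i @[t --> F] --> s`_i) ->
  exp_dd a (f t) @[t --> F] --> exp_dd a s.
Proof.
move=> sf cf; have [K K1 sK] := seq_bound s.
(* The extra 1 covers all nodes within distance 1 of those of [s]. *)
have K2 : 1 <= K + 1 by lra.
pose C := expR (`|a| * (K + 1)).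
apply/cvgrPdist_lt => e e0.
have dist_small : \sum_(i < size s) `|s`_i - (f t)`_i| @[t --> F] --> (0 : R).
  rewrite [X in _ --> X](_ : _ = \sum_(i < size s) (0 : R)); last by rewrite big1.
  apply: cvg_sumR => i _.
  have : s`_i - (f t)`_i @[t --> F] --> s`_i - s`_i.
    by apply: cvgB; [exact: cvg_cst|exact: cf].
  by rewrite subrr => /cvg_norm; rewrite normr0.
have near1 : \forall t \near F, forall i : 'I_(size s), `|s`_i - (f t)`_i| < 1.
  by apply: filter_forall => i; move/cvgrPdist_lt: (cf i (ltn_ord i)) => /(_ _ ltr01).
have near2 : \forall t \near F, C * \sum_(i < size s) `|s`_i - (f t)`_i| < e.
  have : C * \sum_(i < size s) `|s`_i - (f t)`_i| @[t --> F] --> C * 0.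
    by apply: cvgM => //; exact: cvg_cst.
  by rewrite mulr0 => /cvgr_lt; apply.
near=> t.
apply: (@le_lt_trans _ _ (C * \sum_(i < size s) `|s`_i - (f t)`_i|)); last by near: t.
apply: (@exp_dd_lipschitz a (K + 1) [::]) => // x; rewrite cat0s mem_cat => /orP[xs|].
  by rewrite (le_trans (sK _ xs))// lerDl.
move=> /(nthP 0)[i]; rewrite sf => ilt <-.
have h1 := sK _ (mem_nth 0 ilt).
have h : `|s`_i - (f t)`_i| < 1.
  have : forall j : 'I_(size s), `|s`_j - (f t)`_j| < 1 by near: t.
  by move/(_ (Ordinal ilt)).
have := ler_normB s`_i (s`_i - (f t)`_i); rewrite opprB addrC subrK; lra.
Unshelve. all: by end_near. Qed.

End ExponentialDividedDifferences.

(** * Zeros of exponential sums *)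

Section ZeroCounting.
Variable R : realType.
Implicit Types (x y b p : R) (c a : nat -> R) (s : seq R).

Definition expsum_dd m c a s : R := \sum_(j < m) c j * exp_dd (a j) s.

Lemma expsum_dd_move m c a x s1 s2 :
  expsum_dd m c a (s1 ++ x :: s2) = expsum_dd m c a (x :: s1 ++ s2).
Proof. by apply: eq_bigr => j _; rewrite exp_dd_move. Qed.

Lemma expsum_dd_sub m c a x y s :
  expsum_dd m c a (x :: s) - expsum_dd m c a (y :: s)
  = (x - y) * expsum_dd m c a (x :: y :: s).
Proof.
rewrite -sumrB mulr_sumr; apply: eq_bigr => j _.
by rewrite -mulrBr exp_dd_sub mulrCA.
Qed.

Lemma is_derive_expsum m c a x :
  is_derive x 1 (fun y => \sum_(j < m) c j * expR (a j * y))
    (\sum_(j < m) c j * (a j * expR (a j * x))).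
Proof.
rewrite (_ : (fun y => _) = \sum_(j < m) (fun y => c j * expR (a j * y))); last first.
  by apply/funext => y; rewrite fct_sumE.
apply: is_derive_sum => j.
have H : is_derive x 1 (expR \o ( *%R (a j))) (expR (a j * x) * a j).
  have D : is_derive x 1 ( *%R (a j)) (a j).
    have := is_deriveZ (a j) (is_derive_id x 1); rewrite /GRing.scale/= mulr1; exact.
  exact: is_derive1_comp.
by rewrite mulrC in H; exact: (is_deriveZ (c j) H).
Qed.

(* [exp (b x)] times the derivative of [exp (- b x) * sum_j c_j exp (a_j x)] has
   the coefficients [c_j (a_j - b)]: it kills the term with exponent [b]. *)
Lemma expsum_rolle m c a b x y : x < y ->
    expsum_dd m c a [:: x] = 0 -> expsum_dd m c a [:: y] = 0 ->
  exists2 z, x < z < y & expsum_dd m (fun j => c j * (a j - b)) a [:: z] = 0.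
Proof.
move=> xy hx hy.
pose f z := \sum_(j < m) c j * expR ((a j - b) * z).
have fE z : f z = expR (- b * z) * expsum_dd m c a [:: z].
  rewrite mulr_sumr; apply: eq_bigr => j _.
  by rewrite exp_dd1 mulrCA -expRD mulrDl addrC.
have df z := is_derive_expsum m c (fun j => a j - b) z.
have cf : {within `[x, y], continuous f}.
  by apply: derivable_within_continuous => z _; exact: (@ex_derive _ _ _ _ _ _ _ (df z)).
have [|z] := Rolle xy (fun z _ => @ex_derive _ _ _ _ _ _ _ (df z)) cf.
  by change (f x = f y); rewrite !fE hx hy !mulr0.
rewrite in_itv /= => xzy [_ dfz]; exists z => //.
have := @derive_val _ _ _ _ _ _ _ (df z); rewrite dfz => /esym e.
have nz : expR (- b * z) != 0 by rewrite gt_eqF// expR_gt0.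
apply: (mulfI nz); rewrite mulr0 -[RHS]e.
rewrite mulr_sumr; apply: eq_bigr => j _.
by rewrite exp_dd1 mulrCA -expRD mulrA; congr (_ * expR _); ring.
Qed.

(** The operator g -> g' - b g read on Taylor coefficients at [p]: a multiple zero loses at most one
    order. *)
Lemma expsum_dd_shift m c a b r p :
  expsum_dd m (fun j => c j * (a j - b)) a (nseq r.+1 p)
  = r.+1%:R * expsum_dd m c a (nseq r.+2 p) - b * expsum_dd m c a (nseq r.+1 p).
Proof.
rewrite !mulr_sumr -sumrB; apply: eq_bigr => j _.
by rewrite mulrCA exp_dd_nseqS; ring.
Qed.

(* The divided difference at [r.+1] nodes equal to [p] is the [r]-th derivative
   at [p] divided by [r`!]: the sum vanishes on [s] with multiplicities. *)
Definition expsum_vanish m c a s : Prop :=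
  forall p r, (r < count_mem p s)%N -> expsum_dd m c a (nseq r.+1 p) = 0.

(** Only one zero is lost: a repeated zero drops by one order, and Rolle supplies a new zero between
    distinct neighbours. The lower bound and the multiplicity of [x] in [z] serve the induction:
    they fix the multiplicity of the zero added in front. *)
Lemma expsum_vanish_rolle m c a b x s : path <=%R x s ->
    expsum_vanish m c a (x :: s) ->
  exists z, [/\ size z = size s, all (>= x) z, count_mem x z = count_mem x s
    & expsum_vanish m (fun j => c j * (a j - b)) a z].
Proof.
elim: s x => [|y s IH] x /=; first by exists [::].
move=> /andP[xy ys] van.
have van_y : expsum_vanish m c a (y :: s).
  by move=> p r rp; apply: van => /=; apply: leq_trans rp _; exact: leq_addl.
have [z [sz yz cz vz]] := IH y ys van_y.
move: xy; rewrite le_eqVlt => /predU1P[xy|xy].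
  exists (x :: z); split => /=; rewrite ?sz ?lexx//.
  - by rewrite xy.
  - by rewrite xy eqxx cz.
  move=> p r /=; have [<-|xp] := eqVneq x p; last by rewrite add0n => /vz.
  move=> rp; have rp' : (r.+1 < count_mem x [:: x, y & s])%N.
    by move: rp; rewrite /= xy cz eqxx.
  by rewrite expsum_dd_shift (van _ _ rp') (van _ _ (ltnW rp')) !mulr0 subrr.
have ys_min w : w \in y :: s -> y <= w.
  by rewrite inE => /predU1P[->//|]; exact/allP/(order_path_min le_trans ys).
have nx : count_mem x s = 0%N.
  by apply/count_memPn/negP => xs; have := ys_min x; rewrite inE xs orbT leNgt xy => /(_ isT).
have vx : expsum_dd m c a [:: x] = 0 by apply: (van x 0%N); rewrite /= eqxx.
have vy : expsum_dd m c a [:: y] = 0.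
  by apply: (van y 0%N); rewrite /= (lt_eqF xy) eqxx.
have [u /andP[xu uy] u0] := expsum_rolle b xy vx vy.
have zgt w : w \in z -> u < w by move=> /(allP yz); exact: lt_le_trans.
exists (u :: z); split => /=; rewrite ?sz ?(ltW xu)//.
- by apply/allP => w /zgt /ltW; apply: le_trans; exact: ltW.
- rewrite (gt_eqF xu) (gt_eqF xy) nx !addn0; apply/count_memPn/negP => /zgt.
  by rewrite ltNge (ltW xu).
move=> p r /=; have [<-|up] := eqVneq u p; last by rewrite add0n => /vz.
rewrite (_ : count_mem u z = 0)%N; first by rewrite addn0 ltnS leqn0 => /eqP->.
by apply/count_memPn/negP => /zgt; rewrite ltxx.
Qed.

(** Induction on [m]: the operator with b = a_m kills the last term and costs one zero, so c_j (a_j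
    - a_m) = 0 for j < m; the value at one zero then settles c_m. *)
Lemma expsum_vanish_eq0 m c a s : size s = m ->
    (forall i j, (i < m)%N -> (j < m)%N -> a i = a j -> i = j) ->
  expsum_vanish m c a s -> forall j, (j < m)%N -> c j = 0.
Proof.
elim: m c s => // m IH c s ss aI vs.
have [x [t st]] : exists x t, sort <=%R s = x :: t.
  case E : (sort <=%R s) => [|x t]; last by exists x, t.
  by move: ss; rewrite -(size_sort <=%R s) E.
have sorted_s : path <=%R x t by have := sort_le_sorted s; rewrite st.
have vt : expsum_vanish m.+1 c a (x :: t).
  by move=> p r; rewrite -st count_sort; exact: vs.
have [z [sz _ _ vz]] := expsum_vanish_rolle (a m) sorted_s vt.
have c0 j : (j < m)%N -> c j = 0.
  move=> jm; have : c j * (a j - a m) = 0.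
    apply: (IH (fun j => c j * (a j - a m)) z) => //.
    - by move: ss; rewrite -(size_sort <=%R s) st /= sz => -[].
    - by move=> i k im km; apply: aI; rewrite ltnW.
    move=> p r /vz; rewrite /expsum_dd big_ord_recr /= subrr mulr0 mul0r addr0; exact.
  move/eqP; rewrite mulf_eq0 subr_eq0 => /orP[/eqP//|/eqP].
  by move/(aI j m); rewrite ltnS ltnW// => /(_ isT (ltnSn m)) jE; rewrite jE ltnn in jm.
move=> j; rewrite ltnS leq_eqVlt => /predU1P[->|/c0//].
have := vt x 0%N; rewrite /= eqxx /expsum_dd big_ord_recr big1 /= => [|i _]; last first.
  by rewrite c0 ?mul0r.
rewrite add0r exp_dd1 => /(_ isT)/eqP.
by rewrite mulf_eq0 [X in _ || X]gt_eqF ?expR_gt0// orbF => /eqP.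
Qed.

(** These equations say that [c] is in the kernel of the matrix of divided differences at the
    prefixes of [s]. *)
Definition expsum_prefix_vanish m c a s : Prop :=
  forall i, (i < size s)%N -> expsum_dd m c a (take i.+1 s) = 0.

(** For a prefix ending in [y] beyond [x], the divided differences with [x] but not [y], and with
    both, vanish; the recurrence gives the one with [y] but not [x]. *)
Lemma expsum_prefix_vanish_delete m c a s1 x s2 :
  expsum_prefix_vanish m c a (s1 ++ x :: s2) -> expsum_prefix_vanish m c a (s1 ++ s2).
Proof.
move=> van i; rewrite size_cat => ilt.
have [is1|s1i] := ltnP i (size s1).
  have := van i; rewrite !take_cat size_cat /= (leq_trans is1 (leq_addr _ _)).
  move=> /(_ isT); case: (ltnP i.+1 (size s1)) => // h.
  have -> : (i.+1 - size s1 = 0)%N by lia.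
  by rewrite !take0.
pose k := (i - size s1)%N; have ks2 : (k < size s2)%N by rewrite /k; lia.
have iE : i = (size s1 + k)%N by rewrite /k; lia.
have takeE (t : seq R) q : take (size s1 + q) (s1 ++ t) = s1 ++ take q t.
  by rewrite take_cat ltnNge leq_addr /= addKn.
rewrite iE -addnS takeE.
set y := nth 0 s2 k; have tE : take k.+1 s2 = rcons (take k s2) y by exact: take_nth.
have h1 : expsum_dd m c a (x :: s1 ++ take k s2) = 0.
  rewrite -expsum_dd_move -(takeE (x :: s2) k.+1) addnS; apply: van.
  by rewrite size_cat /=; lia.
have h2 : expsum_dd m c a (x :: y :: s1 ++ take k s2) = 0.
  rewrite -(expsum_dd_move _ _ _ x (y :: s1)) /=.
  rewrite -[X in y :: X]cats0 -expsum_dd_move cats1 rcons_cat /= -tE.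
  rewrite -(takeE (x :: s2) k.+2) addnS; apply: van.
  by rewrite size_cat /=; lia.
have := expsum_dd_sub m c a x y (s1 ++ take k s2).
rewrite h1 h2 mulr0 sub0r => /eqP; rewrite oppr_eq0 => /eqP h3.
by rewrite tE -rcons_cat -cats1 expsum_dd_move cats0.
Qed.

Lemma expsum_prefix_vanish_filter m c a (q : pred R) s1 s2 :
    expsum_prefix_vanish m c a (s1 ++ s2) ->
  expsum_prefix_vanish m c a (s1 ++ [seq x <- s2 | q x]).
Proof.
elim: s2 s1 => //= x s2 IH s1 van; case: ifP => _.
  by rewrite -cat_rcons; apply: IH; rewrite cat_rcons.
by apply: IH; exact: expsum_prefix_vanish_delete van.
Qed.

Lemma expsum_prefix_vanishW m c a s :
  expsum_prefix_vanish m c a s -> expsum_vanish m c a s.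
Proof.
(* Deleting all nodes other than [p] leaves prefixes made of copies of [p]. *)
move=> van p r rp; have := @expsum_prefix_vanish_filter m c a (pred1 p) [::] s van r.
have /all_pred1P -> := filter_all (pred1 p) s.
by rewrite size_filter /= size_nseq take_nseq// => /(_ rp).
Qed.

Lemma expsum_prefix_vanish_eq0 m c a s : size s = m ->
    (forall i j, (i < m)%N -> (j < m)%N -> a i = a j -> i = j) ->
  expsum_prefix_vanish m c a s -> forall j, (j < m)%N -> c j = 0.
Proof. by move=> sm aI /expsum_prefix_vanishW; exact: expsum_vanish_eq0. Qed.

End ZeroCounting.

(** * Determinants of divided differences *)

Section DividedDifferenceMatrices.
Variable R : realType.
Implicit Types (q m : nat) (e : nat -> R) (z : seq R).

Definition dd_mx q m e z : 'M[R]_(q, m) :=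
  \matrix_(i, j) exp_dd (e j) (take i.+1 z).

Definition exp_mx q m e z : 'M[R]_(q, m) := \matrix_(i, j) expR (e j * z`_i).

Definition newton_mx q z : 'M[R]_q :=
  \matrix_(i, l) \prod_(r < l) (z`_i - z`_r).

(** Newton's formula with remainder; the recurrence splits the remainder at each further node. *)
Lemma newton_interpolation q z x (a : R) : (q <= size z)%N ->
  expR (a * x) = \sum_(l < q) (\prod_(r < l) (x - z`_r)) * exp_dd a (take l.+1 z)
    + (\prod_(r < q) (x - z`_r)) * exp_dd a (x :: take q z).
Proof.
elim: q => [|q IH] qz.
  by rewrite !big_ord0 take0 add0r mul1r exp_dd1.
rewrite (IH (ltnW qz)) !big_ord_recr /= -addrA; congr (_ + _).
rewrite -mulrA -mulrDr; congr (_ * _).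
rewrite (take_nth 0 qz) -cats1 exp_dd_move cats0.
have := exp_dd_move a z`_q (x :: take q z) [::]; rewrite /= cats0 => ->.
have := exp_dd_sub a x z`_q (take q z).
rewrite -[exp_dd a (x :: z`_q :: _)](exp_dd_move a x [:: z`_q]) /= => H.
by rewrite -H addrC subrK.
Qed.

Lemma exp_mxE q m e z : size z = q -> exp_mx q m e z = newton_mx q z *m dd_mx q m e z.
Proof.
move=> sz; apply/matrixP => i j; rewrite !mxE.
(* At a node z_i the remainder contains the factor z_i - z_i. *)
rewrite (@newton_interpolation q z) ?sz// [X in _ + X](_ : _ = 0) ?addr0.
  by apply: eq_bigr => l _; rewrite !mxE.
by rewrite (bigD1 i)//= subrr !mul0r.
Qed.

Lemma det_newton_mx_neq0 q z : size z = q -> uniq z -> \det (newton_mx q z) != 0.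
Proof.
move=> sz uz; rewrite det_trig; last first.
  apply/is_trig_mxP => i l il; rewrite mxE (bigD1 (Ordinal il))//= subrr mul0r//.
apply/prodf_neq0 => i _; rewrite mxE; apply/prodf_neq0 => r _.
rewrite subr_eq0 nth_uniq ?sz//; last exact: ltn_trans (ltn_ord r) (ltn_ord i).
by rewrite gtn_eqF.
Qed.

(** A kernel vector holds the coefficients of an exponential sum vanishing on all prefixes of [z],
    so it is zero, even at coinciding nodes. *)
Lemma det_dd_mx_neq0 m e z : size z = m ->
    (forall i j, (i < m)%N -> (j < m)%N -> e i = e j -> i = j) ->
  \det (dd_mx m m e z) != 0.
Proof.
move=> sz eI; apply/negP; rewrite -det_tr => /det0P[v /negP v0 vA]; apply: v0.
pose c j := if insub j is Some k then v 0 k else 0.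
have cE (i : 'I_m) : c i = v 0 i by rewrite /c valK.
apply/eqP/rowP => j; rewrite mxE -cE.
apply: (@expsum_prefix_vanish_eq0 _ m c e z) => // i; rewrite sz => im.
move/rowP/(_ (Ordinal im)): vA; rewrite !mxE => E; rewrite -[RHS]E.
by apply: eq_bigr => k _; rewrite !mxE cE.
Qed.

Lemma cvg_dd_mx (T : Type) (F : set_system T) (FF : Filter F) q m e
    (f : T -> seq R) z (i : 'I_q) (j : 'I_m) :
    (forall t, size (f t) = size z) ->
    (forall i, (i < size z)%N -> (f t)`_i @[t --> F] --> z`_i) ->
  dd_mx q m e (f t) i j @[t --> F] --> dd_mx q m e z i j.
Proof.
move=> sf cf; rewrite mxE; under eq_cvg do rewrite mxE.
apply: cvg_exp_dd_seq => [t|l]; first by rewrite !size_take sf.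
rewrite size_take_min leq_min => /andP[li lz]; rewrite nth_take//.
by under eq_cvg do rewrite nth_take//; exact: cf.
Qed.

End DividedDifferenceMatrices.

(** * Density of distinct arguments and extension of identities by continuity *)

Section DistinctArguments.
Variables (R : realType) (m : nat).
Implicit Types (w x : 'rV[R]_m) (e : nat -> R).

Lemma near_right_neq (c : R) : \forall d \near 0^'+, d != c.
Proof.
have [c0|c0] := leP c 0.
  near=> d; have d0 : 0 < d by near: d; exact: nbhs_right_gt.
  by rewrite gt_eqF// (le_lt_trans c0).
by near=> d; rewrite lt_eqF//; near: d; exact: nbhs_right_lt.
Unshelve. all: by end_near. Qed.

(** Along [w + d *: v] with v = (0, 1, ..., m - 1), two given coordinates agree for at most one [d],
    so all are distinct for small d > 0. *)
Lemma closure_pos_distinct w : (forall i, 0 < w 0 i) -> closure (@pos_distinct R m) w.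
Proof.
move=> w0 B Bw; pose v : 'rV[R]_m := \row_i i%:R.
have gw : w + d *: v @[d --> 0^'+] --> w.
  rewrite -[X in _ --> X]addr0 -[X in _ + X](scale0r v).
  apply: cvgD; first exact: cvg_cst.
  by apply: cvgZ; [exact/cvg_at_right_filter/cvg_id|exact: cvg_cst].
have nB : \forall d \near 0^'+, B (w + d *: v) by exact: gw.
have nD : \forall d \near 0^'+, forall ij : 'I_m * 'I_m, ij.1 != ij.2 ->
    (w + d *: v) 0 ij.1 != (w + d *: v) 0 ij.2.
  apply: filter_forall => -[i j] /=; have [->|ij] := eqVneq i j.
    by apply: nearW.
  have ij0 : (j%:R - i%:R : R) != 0 by rewrite subr_eq0 eqr_nat eq_sym.
  have := near_right_neq ((w 0 i - w 0 j) / (j%:R - i%:R)).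
  apply: filterS => d dn _; apply: contra dn => /eqP; rewrite !mxE => h.
  by apply/eqP/(mulIf ij0); rewrite divfK// mulrBr; lra.
near (0 : R)^'+ => d.
have d0 : 0 <= d by near: d; exact: nbhs_right_ge.
exists (w + d *: v); split; last by near: d.
split=> [i|i j].
  by rewrite !mxE ltr_wpDr// mulr_ge0.
apply: contra_eq => ij; move: i j ij.
have h : forall ij : 'I_m * 'I_m, ij.1 != ij.2 ->
    (w + d *: v) 0 ij.1 != (w + d *: v) 0 ij.2 by near: d.
by move=> i j; exact: (h (i, j)).
Unshelve. all: by end_near. Qed.

Definition ln_row x : seq R := [tuple ln (x 0 i) | i < m].

Lemma size_ln_row x : size (ln_row x) = m.
Proof. exact: size_tuple. Qed.

Lemma nth_ln_row x (i : 'I_m) : (ln_row x)`_i = ln (x 0 i).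
Proof. exact: nth_mktuple. Qed.

Lemma uniq_ln_row x : @pos_distinct R m x -> uniq (ln_row x).
Proof.
move=> [x0 xI]; rewrite map_inj_in_uniq ?enum_uniq// => i j _ _ /ln_inj H.
by apply/xI/H; rewrite posrE.
Qed.

Definition to_pos_distinct w : set_system 'rV[R]_m := within (@pos_distinct R m) (nbhs w).

Lemma to_pos_distinct_proper w :
  (forall i, 0 < w 0 i) -> ProperFilter (to_pos_distinct w).
Proof. by move=> w0; apply: within_nbhs_proper; exact: closure_pos_distinct. Qed.

Lemma cvg_ln_row w : (forall i, 0 < w 0 i) -> forall i, (i < size (ln_row w))%N ->
  (ln_row x)`_i @[x --> to_pos_distinct w] --> (ln_row w)`_i.
Proof.
move=> w0 i; rewrite size_ln_row => im; pose k := Ordinal im.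
rewrite (nth_ln_row w k); under eq_cvg do rewrite (nth_ln_row _ k).
apply: cvg_within_filter.
exact: (cvg_comp _ _ (@coord_continuous R 1 m 0 k w) (continuous_ln (w0 k))).
Qed.

Lemma cvg_det_dd_ln_row w e : (forall i, 0 < w 0 i) ->
  \det (dd_mx m m e (ln_row x)) @[x --> to_pos_distinct w] -->
  \det (dd_mx m m e (ln_row w)).
Proof.
move=> w0; apply: cvg_det => i j; apply: cvg_dd_mx => [x|].
  by rewrite !size_ln_row.
exact: cvg_ln_row.
Qed.

(** Serves determinant identities whose proof cancels a Newton determinant, which is zero at
    coinciding nodes. *)
Lemma eq_on_pos_distinct (f g : seq R -> R) :
    (forall w, (forall i, 0 < w 0 i) ->
      f (ln_row x) @[x --> to_pos_distinct w] --> f (ln_row w)) ->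
    (forall w, (forall i, 0 < w 0 i) ->
      g (ln_row x) @[x --> to_pos_distinct w] --> g (ln_row w)) ->
    (forall z, size z = m -> uniq z -> f z = g z) ->
  forall z, size z = m -> f z = g z.
Proof.
move=> cf cg fg z sz; pose w : 'rV[R]_m := \row_i expR z`_i.
have w0 i : 0 < w 0 i by rewrite mxE expR_gt0.
have -> : z = ln_row w.
  apply: (@eq_from_nth _ 0) => [|i]; rewrite ?size_ln_row// sz => im.
  by rewrite (nth_ln_row w (Ordinal im)) mxE expRK.
have FF := to_pos_distinct_proper w0.
apply: (cvg_unique _ (cf w w0)) => //.
apply: cvg_trans (cg w w0); apply: near_eq_cvg.
have : \forall x \near to_pos_distinct w, pos_distinct x by exact: withinT.
by apply: filterS => x px; rewrite fg ?size_ln_row// uniq_ln_row.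
Qed.

End DistinctArguments.

(** * Schur functions *)

Section SchurFunction.
Variable R : realType.
Implicit Types (m : nat) (nu z : seq R).

(* The exponents of the numerator of [S_nu], listed in increasing order. *)
Definition schur_exp nu m (j : nat) : R := nu`_(m - j.+1) + j%:R.

Definition dd_ratio nu m z : R :=
  \det (dd_mx m m (schur_exp nu m) z) / \det (dd_mx m m (fun j => j%:R) z).

(** Sign of the reversal of the columns, over the sign that turns each v_i - v_j into v_j - v_i. *)
Definition schur_sign m : R :=
  (-1) ^+ (perm (@rev_ord_inj m))^-1%g /
  \prod_(i < m) \prod_(j < m | (i < j)%N) -1.

Lemma schur_sign_neq0 m : schur_sign m != 0.
Proof.
rewrite mulf_neq0 ?signr_eq0// invr_eq0; apply/prodf_neq0 => i _.
by apply/prodf_neq0 => j _; rewrite oppr_eq0 oner_eq0.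
Qed.

Lemma det_dd_mx_natr_neq0 m z : size z = m -> \det (dd_mx m m (fun j => j%:R) z) != 0.
Proof. by move=> sz; apply: det_dd_mx_neq0 => // i j _ _ /eqP; rewrite eqr_nat => /eqP. Qed.

Lemma det_exp_mx_natr m (x : 'rV[R]_m) : (forall i, 0 < x 0 i) ->
  \det (exp_mx m m (fun j => j%:R) (ln_row x))
  = \prod_(i < m) \prod_(j < m | (i < j)%N) (x 0 j - x 0 i).
Proof.
move=> x0; rewrite -det_Vandermonde -det_tr; congr (\det _).
apply/matrixP => j i; rewrite !mxE nth_ln_row expRM_natl lnK//.
by rewrite posrE.
Qed.

(** Numerator and Vandermonde denominator are exponential determinants at the same nodes ln x_i;
    their common Newton factor cancels. *)
Lemma schur_quotientE nu m (x : 'rV[R]_m) : @pos_distinct R m x ->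
  schur_quotient nu x = schur_sign m * dd_ratio nu m (ln_row x).
Proof.
move=> px; have [x0 _] := px.
have sz := size_ln_row x.
have N0 : \det (newton_mx m (ln_row x)) != 0.
  by rewrite det_newton_mx_neq0// uniq_ln_row.
rewrite /schur_quotient.
rewrite (_ : \matrix_(i, j) _ =
    col_perm (perm (@rev_ord_inj m)) (exp_mx m m (schur_exp nu m) (ln_row x))); last first.
  apply/matrixP => i j; rewrite !mxE permE nth_ln_row [in RHS]mulrC expRM lnK ?posrE//.
  have -> : schur_exp nu m (m - j.+1) = nu`_j + (m - j.+1)%:R.
    by rewrite /schur_exp; congr (nu`_ _ + _); have := ltn_ord j; lia.
  by [].
rewrite col_permE det_mulmx det_perm (exp_mxE _ _ sz) det_mulmx.
rewrite (_ : \prod_i _ = \prod_(i < m) \prod_(j < m | (i < j)%N) -1 *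
    \det (exp_mx m m (fun j => j%:R) (ln_row x))); last first.
  rewrite det_exp_mx_natr// -big_split; apply: eq_bigr => i _.
  by rewrite -big_split; apply: eq_bigr => j _; rewrite /= mulN1r opprB.
rewrite (exp_mxE _ _ sz) det_mulmx /schur_sign /dd_ratio.
have C0 : \prod_(i < m) \prod_(j < m | (i < j)%N) -1 != 0 :> R.
  apply/prodf_neq0 => i _; apply/prodf_neq0 => j _.
  by rewrite oppr_eq0 oner_eq0.
have b0 := det_dd_mx_natr_neq0 sz.
set a := \det (newton_mx _ _) in N0 *; set b := \det (dd_mx _ _ _ _) in b0 *.
set c := \det (dd_mx _ _ _ _); set d := \prod_(i < m) _ in C0 *.
set s := (-1) ^+ _; clearbody a b c d s.
by field; rewrite N0 b0 C0.
Qed.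

(** The right-hand side is continuous in the arguments, so it is also the limit that defines [schur]
    at coinciding ones. *)
Lemma schurE nu m (v : m.-tuple R) : (forall i, 0 < tnth v i) ->
  schur nu v = schur_sign m * dd_ratio nu m (map (@ln R) v).
Proof.
move=> v0; rewrite /schur; set w := \row_i _.
have w0 i : 0 < w 0 i by rewrite mxE.
have -> : map (@ln R) v = ln_row w.
  apply: (@eq_from_nth _ 0) => [|i]; rewrite size_map size_tuple ?size_ln_row// => im.
  rewrite (nth_ln_row w (Ordinal im)) mxE (nth_map 0) ?size_tuple//.
  by rewrite (tnth_nth 0).
case: ifPn => [/set_mem|_]; first exact: schur_quotientE.
have FF := to_pos_distinct_proper w0.
have : schur_sign m * dd_ratio nu m (ln_row x) @[x --> to_pos_distinct w] -->
    schur_sign m * dd_ratio nu m (ln_row w).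
  apply: cvgM; first exact: cvg_cst.
  apply: cvgM; first exact: cvg_det_dd_ln_row.
  apply: cvgV; first by rewrite det_dd_mx_natr_neq0// size_ln_row.
  exact: cvg_det_dd_ln_row.
move=> cv; apply/cvg_lim => //; apply: cvg_trans cv; apply: near_eq_cvg.
have : \forall x \near to_pos_distinct w, pos_distinct x by exact: withinT.
by apply: filterS => x px; rewrite schur_quotientE.
Qed.

End SchurFunction.

(** * Determinants with a group of equal arguments tending to 0 *)

Section EqualArgumentsAtZero.
Variable R : realType.
Implicit Types (k p q m : nat) (e : nat -> R) (z : seq R).

(** At distinct nodes, adding [c] to all exponents multiplies the determinant by prod_i exp (c z_i),
    whatever the exponents. *)
Lemma det_dd_mx_shift p e e' (c : R) z : size z = p ->
  \det (dd_mx p p (fun j => e j + c) z) * \det (dd_mx p p e' z)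
  = \det (dd_mx p p (fun j => e' j + c) z) * \det (dd_mx p p e z).
Proof.
move: z; apply: eq_on_pos_distinct => [w w0|w w0|z sz uz].
- by apply: cvgM; exact: cvg_det_dd_ln_row.
- by apply: cvgM; exact: cvg_det_dd_ln_row.
have N0 := det_newton_mx_neq0 sz uz.
have E d : \det (dd_mx p p (fun j => d j + c) z)
    = (\prod_(i < p) expR (c * z`_i)) * \det (dd_mx p p d z).
  apply: (mulfI N0); rewrite mulrCA -!det_mulmx -!exp_mxE//.
  transitivity (\det (diag_mx (\row_(i < p) expR (c * z`_i)) *m exp_mx p p d z)).
    congr (\det _); apply/matrixP => i j; rewrite mul_diag_mx !mxE -expRD.
    by rewrite mulrDl addrC.
  by rewrite det_mulmx det_diag; congr (_ * _); apply: eq_bigr => i _; rewrite mxE.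
by rewrite (E e) (E e') -!mulrA; congr (_ * _); exact: mulrC.
Qed.

Definition block_dd_mx k p e z : 'M[R]_(k + p) :=
  col_mx (dd_mx k (k + p) e (take k z)) (dd_mx p (k + p) e (drop k z)).

Lemma exp_mx_block k p e z : size z = (k + p)%N ->
  exp_mx (k + p) (k + p) e z
  = block_mx (newton_mx k (take k z)) 0 0 (newton_mx p (drop k z))
    *m block_dd_mx k p e z.
Proof.
move=> sz; rewrite mul_block_col !mul0mx addr0 add0r -!exp_mxE; first last.
- by rewrite size_takel// sz leq_addr.
- by rewrite size_drop sz addKn.
apply/matrixP => i j; rewrite !mxE; case: splitP => l il; rewrite mxE il.
  by rewrite nth_take.
by rewrite nth_drop.
Qed.

(* The two determinants are proportional, with a factor that does not depend on
   the exponents; the cross-multiplied form spares computing it. *)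
Lemma det_dd_mx_block k p e e' z : size z = (k + p)%N ->
  \det (dd_mx (k + p) (k + p) e z) * \det (block_dd_mx k p e' z)
  = \det (dd_mx (k + p) (k + p) e' z) * \det (block_dd_mx k p e z).
Proof.
have cvg_block (w : 'rV[R]_(k + p)) d : (forall i, 0 < w 0 i) ->
    \det (block_dd_mx k p d (ln_row x)) @[x --> to_pos_distinct w] -->
    \det (block_dd_mx k p d (ln_row w)).
  move=> w0; apply: cvg_det => i j; rewrite mxE.
  under eq_cvg do rewrite mxE.
  case: splitP => l _; apply: cvg_dd_mx => [x|r].
  - by rewrite !size_take !size_ln_row.
  - rewrite size_take_min leq_min => /andP[rk rm]; rewrite nth_take//.
    by under eq_cvg do rewrite nth_take//; exact: cvg_ln_row.
  - by rewrite !size_drop !size_ln_row.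
  rewrite size_drop => rm; rewrite nth_drop; under eq_cvg do rewrite nth_drop.
  by apply: cvg_ln_row => //; lia.
move: z; apply: eq_on_pos_distinct => [w w0|w w0|z sz uz].
- by apply: cvgM; [exact: cvg_det_dd_ln_row|exact: cvg_block].
- by apply: cvgM; [exact: cvg_det_dd_ln_row|exact: cvg_block].
have N0 := det_newton_mx_neq0 sz uz.
have E d : \det (newton_mx (k + p) z) * \det (dd_mx (k + p) (k + p) d z)
    = (\det (newton_mx k (take k z)) * \det (newton_mx p (drop k z)))
      * \det (block_dd_mx k p d z).
  by rewrite -det_mulmx -exp_mxE// exp_mx_block// det_mulmx det_ublock.
by apply: (mulfI N0); rewrite !mulrA !E mulrAC.
Qed.

Lemma det_scale m (A : 'M[R]_m) (r c : 'I_m -> R) :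
  \det (\matrix_(i, j) (r i * A i j * c j))
  = (\prod_i r i) * (\prod_j c j) * \det A.
Proof.
transitivity (\det (diag_mx (\row_i r i) *m A *m diag_mx (\row_j c j))).
  by congr (\det _); apply/matrixP => i j; rewrite mul_mx_diag mul_diag_mx !mxE.
rewrite !det_mulmx !det_diag mulrAC; congr (_ * _ * _);
  by apply: eq_bigr => i _; rewrite mxE.
Qed.

(* With [b] separating the [k] smallest exponents from the others, these
   scalings leave the diagonal blocks of order 1 and make the other two tend
   to 0. *)
Definition row_scale k (b eps : R) (i : nat) : R :=
  if (i < k)%N then eps `^ (- b) else 1.

Definition col_scale k e (b eps : R) (j : nat) : R :=
  if (j < k)%N then eps `^ (b - e j) else 1.

Definition block_scale k p e (b eps : R) : R :=
  (\prod_(i < k + p) row_scale k b eps i)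
  * (\prod_(j < k + p) col_scale k e b eps j).

Lemma block_scale_neq0 k p e b (eps : R) : 0 < eps -> block_scale k p e b eps != 0.
Proof.
move=> e0; rewrite mulf_neq0//; apply/prodf_neq0 => i _;
  rewrite /row_scale /col_scale; case: ifP => _; rewrite ?oner_eq0//;
  by rewrite gt_eqF// powR_gt0.
Qed.

(** The upper rows are constants times eps^(e_j), the lower rows are free of [eps]. After scaling,
    the powers of [eps] in the upper blocks are 0 and e_j - b, in the lower ones b - e_j and 0; the
    choice of [b] makes the off-diagonal ones positive. *)
Lemma cvg_det_block_dd_mx k p e (b : R) z : size z = p ->
    (forall j, (j < k)%N -> e j < b) ->
    (forall j, (k <= j < k + p)%N -> b < e j) ->
  block_scale k p e b eps * \det (block_dd_mx k p e (nseq k (ln eps) ++ z))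
    @[eps --> 0^'+] -->
  \det (dd_mx k k e (nseq k 0)) * \det (dd_mx p p (fun j => e (k + j)%N) z).
Proof.
move=> sz eb be; rewrite -(@det_ublock _ _ _ _ 0).
under eq_cvg do rewrite -det_scale.
have pow0 (f : R -> R) (a x : R) : 0 < a ->
    (forall eps, 0 < eps -> f eps = x * eps `^ a) -> f eps @[eps --> 0^'+] --> 0.
  move=> a0 fE.
  have : x * eps `^ a @[eps --> 0^'+] --> x * 0.
    by apply: cvgM; [exact: cvg_cst|exact: powR_cvg0].
  rewrite mulr0; apply: cvg_trans; apply: near_eq_cvg; near=> eps.
  by rewrite fE//; near: eps; exact: nbhs_right_gt.
have upE (eps : R) (l : 'I_k) (i : 'I_(k + p)) : 0 < eps ->
    dd_mx k (k + p) e (take k (nseq k (ln eps) ++ z)) l i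
    = e i ^+ l / l`!%:R * eps `^ (e i).
  move=> e0; rewrite mxE take_size_cat ?size_nseq// take_nseq// exp_dd_nseq.
  by rewrite [e i * _]mulrC expRM lnK ?posrE.
have loE (eps : R) (l : 'I_p) (i : 'I_(k + p)) :
    dd_mx p (k + p) e (drop k (nseq k (ln eps) ++ z)) l i
    = exp_dd (e i) (take l.+1 z).
  by rewrite mxE drop_size_cat ?size_nseq.
have powD (eps a c : R) : 0 < eps -> eps `^ a * eps `^ c = eps `^ (a + c).
  by move=> e0; rewrite powRD// (gt_eqF e0) implybT.
pose A eps i j := row_scale k b eps (i : 'I_(k + p))
  * block_dd_mx k p e (nseq k (ln eps) ++ z) i j * col_scale k e b eps j.
have ul (i j : 'I_k) : A eps (lshift p i) (lshift p j) @[eps --> 0^'+] -->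
    dd_mx k k e (nseq k 0) i j.
  have -> : dd_mx k k e (nseq k 0) i j = e j ^+ i / i`!%:R.
    by rewrite mxE take_nseq// exp_dd_nseq mulr0 expR0 mulr1.
  have : cst (e j ^+ i / i`!%:R) @ (0 : R)^'+ --> e j ^+ i / i`!%:R.
    exact: cvg_cst.
  apply: cvg_trans; apply: near_eq_cvg; near=> eps.
  have e0 : 0 < eps by near: eps; exact: nbhs_right_gt.
  rewrite /A col_mxEu upE// /row_scale /col_scale /= !ltn_ord mulrCA -mulrA.
  rewrite !powD//.
  by rewrite (_ : _ + _ = 0) ?powRr0 ?mulr1//; ring.
have ur (i : 'I_k) (j : 'I_p) :
    A eps (lshift p i) (rshift k j) @[eps --> 0^'+] --> 0.
  apply: (pow0 _ (e (k + j)%N - b) (e (k + j)%N ^+ i / i`!%:R)).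
    by rewrite subr_gt0 be// leq_addr ltn_add2l ltn_ord.
  move=> eps e0; rewrite /A col_mxEu upE// /row_scale /col_scale /= ltn_ord.
  rewrite ltnNge leq_addr /= mulr1 mulrCA powD//.
  by rewrite addrC.
have dl (i : 'I_p) (j : 'I_k) :
    A eps (rshift k i) (lshift p j) @[eps --> 0^'+] --> 0.
  apply: (pow0 _ (b - e j) (exp_dd (e j) (take i.+1 z))).
    by rewrite subr_gt0 eb.
  move=> eps e0; rewrite /A col_mxEd loE /row_scale /col_scale /= ltn_ord.
  by rewrite ltnNge leq_addr /= mul1r.
have dr (i j : 'I_p) : A eps (rshift k i) (rshift k j) @[eps --> 0^'+] -->
    dd_mx p p (fun j => e (k + j)%N) z i j.
  rewrite mxE (_ : (fun eps => _) = cst (exp_dd (e (k + j)%N) (take i.+1 z))).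
    exact: cvg_cst.
  apply/funext => eps; rewrite /A col_mxEd loE /row_scale /col_scale /=.
  by rewrite !ltnNge !leq_addr /= mul1r mulr1.
apply: cvg_det => i j; under eq_cvg do rewrite mxE -/(A _ i j).
case: (split_ordP i) => {}i ->; case: (split_ordP j) => {}j ->.
- by rewrite block_mxEul; exact: ul.
- by rewrite block_mxEur mxE; exact: ur.
- by rewrite block_mxEdl mxE; exact: dl.
- by rewrite block_mxEdr; exact: dr.
Unshelve. all: by end_near. Qed.

End EqualArgumentsAtZero.

(** * Asymptotics of Schur functions *)

Section SchurAsymptotics.
Variable R : realType.
Implicit Types (k p m : nat) (nu z : seq R).

Lemma eq_schur nu nu' m (v : m.-tuple R) :
  (forall i, (i < m)%N -> nu`_i = nu'`_i) -> schur nu v = schur nu' v.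
Proof.
move=> nuE; rewrite /schur (_ : @schur_quotient R nu m = @schur_quotient R nu' m)//.
apply/funext => x; rewrite /schur_quotient; congr (\det _ / _).
by apply/matrixP => i j; rewrite !mxE nuE.
Qed.

Lemma real_partition_behead nu : real_partition nu -> real_partition (behead nu).
Proof.
move=> hnu i; rewrite size_behead => isz; rewrite !nth_behead.
by have := hnu i.+1 ltac:(lia); rewrite -(natr1 i.+1) -(natr1 i); lra.
Qed.

Lemma schur_exp_lt nu m i j : real_partition nu -> (i < j < m)%N ->
  schur_exp nu m i < schur_exp nu m j.
Proof.
(* At the last component this reads nu_n > -1, and in the zero padding 0 < 1, so padding keeps the
   exponents increasing. *)
move=> hnu; have step l : nu`_l.+1 < nu`_l + 1.
  have [lsz|szl] := ltnP l (size nu); last by rewrite !nth_default ?leqW//; lra.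
  by have := hnu l lsz; rewrite -natr1; lra.
elim: j => // j IH /andP[ij jm].
have stepj : schur_exp nu m j < schur_exp nu m j.+1.
  rewrite /schur_exp (_ : (m - j.+1 = (m - j.+2).+1)%N); last by lia.
  by have := step (m - j.+2)%N; rewrite -natr1; lra.
move: ij; rewrite ltnS leq_eqVlt => /predU1P[->//|ij].
by apply: lt_trans stepj; apply: IH; rewrite ij ltnW.
Qed.

Lemma schur_exp_inj nu m i j : real_partition nu -> (i < m)%N -> (j < m)%N ->
  schur_exp nu m i = schur_exp nu m j -> i = j.
Proof.
move=> hnu im jm eij; case: (ltngtP i j) => // h.
  by have := @schur_exp_lt nu m i j hnu; rewrite h jm eij ltxx => /(_ isT).
by have := @schur_exp_lt nu m j i hnu; rewrite h im eij ltxx => /(_ isT).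
Qed.

Lemma schur_neq0 nu m (v : m.-tuple R) : real_partition nu ->
  (forall i, 0 < tnth v i) -> schur nu v != 0.
Proof.
move=> hnu v0; rewrite schurE//; apply: mulf_neq0; first exact: schur_sign_neq0.
have sv : size (map (@ln R) v) = m by rewrite size_map size_tuple.
apply: mulf_neq0; last by rewrite invr_eq0; exact: det_dd_mx_natr_neq0.
by apply: det_dd_mx_neq0 => // i j; exact: schur_exp_inj.
Qed.

Lemma increasing_separator k p (e : nat -> R) :
    (forall i j, (i < j < k + p.+1)%N -> e i < e j) ->
  exists b, (forall j, (j < k)%N -> e j < b) /\
    (forall j, (k <= j < k + p.+1)%N -> b < e j).
Proof.
move=> elt; case: k elt => [|k] elt.
  exists (e 0%N - 1); split => // -[|j] jp; first by lra.
  by have := elt 0%N j.+1; rewrite jp => /(_ isT); lra.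
have eS : e k < e k.+1 by apply: elt; lia.
exists ((e k + e k.+1) / 2); split => j jk.
  have : e j <= e k.
    by have [->//|jk'] := eqVneq j k; apply/ltW/elt; lia.
  lra.
have : e k.+1 <= e j.
  by have [->//|jk'] := eqVneq j k.+1; apply/ltW/elt; lia.
lra.
Qed.

(** [C] and [omega] are chosen before [V], hence shared by Schur functions that differ only in their
    last arguments. *)
Lemma schur_cvg_at0 nu k p : real_partition nu ->
  exists (C : R) (omega : R -> R), [/\ C != 0, forall eps, 0 < eps -> omega eps != 0 &
    forall V : p.+1.-tuple R, (forall i, 0 < tnth V i) ->
      omega eps * schur nu [tuple of nseq k eps ++ V] @[eps --> 0^'+]
        --> C * schur nu V].
Proof.
move=> hnu; set m := (k + p.+1)%N.
pose e := schur_exp nu m; pose f (j : nat) : R := j%:R.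
have [b [eb be]] := @increasing_separator k p e (fun i j h => schur_exp_lt hnu h).
have [c [fc cf]] := @increasing_separator k p f
  (fun i j h => ltac:(by rewrite ltr_nat; case/andP: h)).
pose D d := \det (dd_mx k k d (nseq k (0 : R))).
have sk (x : R) : size (nseq k x) = k by rewrite size_nseq.
have De : D e != 0.
  apply: det_dd_mx_neq0 => // i j ik jk.
  by apply: schur_exp_inj => //; apply: leq_trans (leq_addr _ _).
have Df : D f != 0 by exact: det_dd_mx_natr_neq0.
(* [D] is the limit of the diagonal block of the equal arguments, at [k] nodes 0; [omega] is the
   quotient of the scalings of numerator and denominator. *)
exists (schur_sign R m / schur_sign R p.+1 * (D e / D f)).
exists (fun eps => block_scale k p.+1 e b eps / block_scale k p.+1 f c eps).
split.
- by apply: mulf_neq0; apply: mulf_neq0; rewrite ?invr_eq0 //; exact: schur_sign_neq0.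
- by move=> eps e0; apply: mulf_neq0; rewrite ?invr_eq0; exact: block_scale_neq0.
move=> V V0; pose z := map (@ln R) V.
have sz : size z = p.+1 by rewrite size_map size_tuple.
pose zeps eps := nseq k (ln eps) ++ z.
pose B d eps := \det (block_dd_mx k p.+1 d (zeps eps)).
pose L d := \det (dd_mx p.+1 p.+1 d z).
(* The last p + 1 exponents for [m] arguments are those for p + 1 arguments shifted by [k], so the
   leading components of [nu] remain. The denominator is shifted alike, and the shift cancels in the
   quotient. *)
have eE : (fun j => e (k + j)%N) = (fun j => schur_exp nu p.+1 j + k%:R).
  by apply/funext => j; rewrite /e /schur_exp /m -addnS subnDl natrD; ring.
have fE : (fun j => f (k + j)%N) = (fun j => f j + k%:R).
  by apply/funext => j; rewrite /f natrD addrC.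
have Be := cvg_det_block_dd_mx sz eb be; rewrite eE in Be.
have Bf := cvg_det_block_dd_mx sz fc cf; rewrite fE in Bf.
have Lf : L f != 0 by exact: det_dd_mx_natr_neq0.
have Lfk : L (fun j => f j + k%:R) != 0.
  by apply: det_dd_mx_neq0 => // i j _ _ /addIr/eqP; rewrite eqr_nat => /eqP.
have shift := det_dd_mx_shift (schur_exp nu p.+1) f k%:R sz.
have -> : schur_sign R m / schur_sign R p.+1 * (D e / D f) * schur nu V
    = schur_sign R m * ((D e * L (fun j => schur_exp nu p.+1 j + k%:R))
        / (D f * L (fun j => f j + k%:R))).
  rewrite schurE// /dd_ratio -/z -/f -/(L f) -/(L (schur_exp nu p.+1)).
  have s0 := schur_sign_neq0 R p.+1.
  have -> : L (fun j => schur_exp nu p.+1 j + k%:R)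
      = L (fun j => f j + k%:R) * L (schur_exp nu p.+1) / L f.
    by rewrite -shift mulfK.
  move: (schur_sign R m) (schur_sign R p.+1) (D e) (D f) (L f) (L _) (L _)
    s0 Df Lf Lfk => s s' d d' l l1 l2 s0 d0 l0 l10.
  by field; rewrite ?s0 ?d0 ?l0 ?l10.
have lim : schur_sign R m * ((block_scale k p.+1 e b eps * B e eps)
      / (block_scale k p.+1 f c eps * B f eps)) @[eps --> 0^'+]
    --> schur_sign R m * ((D e * L (fun j => schur_exp nu p.+1 j + k%:R))
        / (D f * L (fun j => f j + k%:R))).
  apply: cvgM; first exact: cvg_cst.
  apply: cvgM; first exact: Be.
  by apply: cvgV; [rewrite mulf_neq0|exact: Bf].
(* For k > 0 the block determinant vanishes when [ln eps] is a node of [z]; its nonzero limit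
   excludes this near 0. *)
have nB : \forall eps \near 0^'+, block_scale k p.+1 f c eps * B f eps != 0.
  have DL : D f * L (fun j => f j + k%:R) != 0 by rewrite mulf_neq0.
  exact: (cvgr_neq0 _ Bf DL).
apply: cvg_trans lim; apply: near_eq_cvg; near=> eps.
have e0 : 0 < eps by near: eps; exact: nbhs_right_gt.
have : block_scale k p.+1 f c eps * B f eps != 0 by near: eps.
rewrite mulf_eq0 negb_or => /andP[sf0 Bf0].
have se0 := block_scale_neq0 k p.+1 e b e0.
have szeps : size (zeps eps) = m by rewrite size_cat size_nseq sz.
have mapE : map (@ln R) (nseq k eps ++ V) = zeps eps by rewrite map_cat map_nseq.
rewrite schurE; last first.
  move=> i; rewrite (tnth_nth 0) /= nth_cat size_nseq; case: ltnP => [ik|ki].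
    by rewrite nth_nseq ik.
  have iV : (i - k < p.+1)%N by have := ltn_ord i; lia.
  by have := V0 (Ordinal iV); rewrite (tnth_nth 0).
rewrite /dd_ratio mapE -/m -/e -/f.
have G0 : \det (dd_mx m m f (zeps eps)) != 0 by exact: det_dd_mx_natr_neq0.
have cross := det_dd_mx_block e f szeps.
rewrite -[RHS]mulrCA; congr (_ * _).
have -> : \det (dd_mx m m e (zeps eps)) / \det (dd_mx m m f (zeps eps))
    = B e eps / B f eps.
  by apply/eqP; rewrite eqr_div// cross mulrC.
by rewrite mulf_div.
Unshelve. all: by end_near. Qed.

End SchurAsymptotics.

(** * The limit of the pseudo-affinity factor *)

Theorem proposition10 (R : realType) (n : nat) (hn : (1 <= n)%N)
  (lam : n.-tuple R) (hlam : real_partition lam)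
  (j : nat) (hj : (j <= n - 1)%N)
  (U : (n - 1 - j).-tuple R) (hU : forall i, 0 < tnth U i <= 1)
  (t : R) (ht : 0 < t <= 1) :
  let mu := take (n - j) lam in
  let eta := behead (take (n - j + 1) (rcons lam 0)) in
  cvg (pseudo_affinity_at lam j U t eps @[eps --> 0^'+]) /\
  pseudo_affinity lam j U t =
    t * ((schur mu [tuple of rcons U t] * schur eta [tuple of rcons U 1])
         / (schur mu [tuple of rcons U 1] * schur eta [tuple of rcons U t])).
Proof.
move=> mu eta.
have muE V : schur mu V = schur lam (V : (n - 1 - j).+1.-tuple R).
  by apply: eq_schur => i ij; rewrite nth_take//; lia.
(* The appended zero, reached only for j = 0, equals the default value read beyond the end of
   [lam]. *)
have etaE V : schur eta V = schur (behead lam) (V : (n - 1 - j).+1.-tuple R).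
  apply: eq_schur => i ij; rewrite !nth_behead nth_take; last by lia.
  rewrite nth_rcons size_tuple; case: ltngtP => // h.
    by rewrite nth_default// size_tuple ltnW.
  by rewrite nth_default// size_tuple h.
have V0 s : 0 < s -> forall i, 0 < tnth [tuple of rcons U s] i.
  move=> s0 i; have : all (fun x => 0 < x) (rcons U s).
    rewrite all_rcons s0; apply/allP => x /tnthP[l ->].
    by case/andP: (hU l).
  by move/allP; apply; exact: mem_tnth.
have t0 : 0 < t by case/andP: ht.
have hlam' := real_partition_behead hlam.
(* One pair of normalisations for [lam] with j + 1 arguments [eps], another for its bottom partition
   with [j]; each occurs once above and once below the fraction bar. *)
have [C [w [C0 w0 cw]]] := schur_cvg_at0 j.+1 (n - 1 - j) hlam.
have [C' [w' [C'0 w'0 cw']]] := schur_cvg_at0 j (n - 1 - j) hlam'.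
pose M s := schur lam [tuple of rcons U s].
pose N s := schur (behead lam) [tuple of rcons U s].
have M0 s : 0 < s -> M s != 0 by move=> s0; apply: schur_neq0 => //; exact: V0.
have N0 s : 0 < s -> N s != 0 by move=> s0; apply: schur_neq0 => //; exact: V0.
rewrite !muE !etaE -!/(M _) -!/(N _).
suff lim : pseudo_affinity_at lam j U t eps @[eps --> 0^'+] -->
    t * ((M t * N 1) / (M 1 * N t)).
  by split; [apply/cvg_ex; eexists; exact: lim|exact/cvg_lim].
have -> : t * ((M t * N 1) / (M 1 * N t))
    = t * (((C * M t) * (C' * N 1)) / ((C * M 1) * (C' * N t))).
  congr (t * _); have := M0 1 ltr01; have := N0 t t0.
  move: (M t) (N 1) (M 1) (N t) => a b c d d0 c0.
  by field; rewrite C0 C'0 c0 d0.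
pose P s eps := w eps * schur lam [tuple of nseq j.+1 eps ++ rcons U s].
pose Q s eps := w' eps * schur (behead lam) [tuple of nseq j eps ++ rcons U s].
have cP s : 0 < s -> P s eps @[eps --> 0^'+] --> C * M s.
  by move=> s0; exact: (cw _ (V0 s s0)).
have cQ s : 0 < s -> Q s eps @[eps --> 0^'+] --> C' * N s.
  by move=> s0; exact: (cw' _ (V0 s s0)).
have : t * ((P t eps * Q 1 eps) / (P 1 eps * Q t eps)) @[eps --> 0^'+] -->
    t * (((C * M t) * (C' * N 1)) / ((C * M 1) * (C' * N t))).
  apply: cvgM; first exact: cvg_cst.
  apply: cvgM; first by apply: cvgM; [exact: cP|exact: cQ].
  apply: cvgV; last by apply: cvgM; [exact: cP|exact: cQ].
  exact: (mulf_neq0 (mulf_neq0 C0 (M0 _ ltr01)) (mulf_neq0 C'0 (N0 _ t0))).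
(* For eps > 0 the factors [w eps] and [w' eps] are nonzero and cancel exactly. *)
apply: cvg_trans; apply: near_eq_cvg; near=> eps.
have e0 : 0 < eps by near: eps; exact: nbhs_right_gt.
have wE (a b c d : R) : w eps * a * (w' eps * b) / (w eps * c * (w' eps * d))
    = a * b / (c * d).
  by rewrite (mulrACA _ a) (mulrACA _ c) -mulf_div divff ?mul1r// mulf_neq0 ?w0 ?w'0.
rewrite /pseudo_affinity_at; congr (t * _); exact: wE.
Unshelve. all: by end_near. Qed.
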